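(* Let $\alpha\in(-1,1)$, $\beta^-,\beta^+>0$, $\xi,\eta\in\mathbb{R}$, let $f$ be a real-valued function on $\Omega^-\cup\Omega^+=(-1,\alpha)\cup(\alpha,1)$ and let $g:\mathbb{R}^2\to\mathbb{R}$. Let $u$ be a solution of the interface problem $$-(\beta u')'=f \ \text{ in } \Omega^-\cup\Omega^+,\qquad u(-1)=\xi,\quad u(1)=\eta,\qquad [\beta u']_\alpha=0,\qquad [u]_\alpha=g(u^+(\alpha),u^-(\alpha)).$$ Let $u_0$ be the zero-jump component and $u_1$ the unit-jump response defined in the context. Then there exists a scalar $s\in\mathbb{R}$ such that $$u=u_0+s\,u_1,\qquad s=[u]_\alpha .$$
   Context: The domain is $\Omega=(-1,1)$ with interface point $\alpha\in(-1,1)$, $\Omega^-=(-1,\alpha)$, $\Omega^+=(\alpha,1)$. The coefficient is piecewise constant: $\beta(x)=\beta^-$ for $x<\alpha$ and $\beta(x)=\beta^+$ for $x>\alpha$, with $\beta^\pm>0$. For a function $v$ on $\Omega^-\cup\Omega^+$, $v^+(\alpha)$ and $v^-(\alpha)$ denote its one-sided limits (traces) at $\alpha$ from the right and from the left, and $[v]_\alpha=v^+(\alpha)-v^-(\alpha)$ is the jump; $[\beta v']_\alpha=\beta^+ (v')^+(\alpha)-\beta^-(v')^-(\alpha)$. Solutions are understood in the classical sense: a solution is twice differentiable in each of $\Omega^-$ and $\Omega^+$, satisfies the differential equation pointwise there, extends continuously to the endpoints $\pm1$, and it and its first derivative have one-sided limits at $\alpha$. The zero-jump component $u_0$ is the solution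 of $-(\beta u_0')'=f$ in $\Omega^-\cup\Omega^+$, $u_0(-1)=\xi$, $u_0(1)=\eta$, $[u_0]_\alpha=0$, $[\beta u_0']_\alpha=0$ (the data $f$ being such that it exists). The unit-jump response $u_1$ is the solution of $-(\beta u_1')'=0$ in $\Omega^-\cup\Omega^+$, $u_1(-1)=0$, $u_1(1)=0$, $[u_1]_\alpha=1$, $[\beta u_1']_\alpha=0$. *)

(* Defs.v *)
From HB Require Import structures.
From mathcomp Require Import all_boot all_order all_algebra.
From mathcomp Require Import all_classical all_reals all_analysis.

Set Implicit Arguments.
Unset Strict Implicit.
Unset Printing Implicit Defensive.

Import Order.TTheory GRing.Theory Num.Theory.
Import numFieldNormedType.Exports.

Local Open Scope ring_scope.
Local Open Scope classical_set_scope.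

(* A function on Omega^- `|` Omega^+ is represented by a total v : R -> R whose
   values outside Omega^- `|` Omega^+ (in particular at -1, alpha and 1) are
   irrelevant: endpoint and interface values are always one-sided limits. *)

Section InterfaceProblem.
Context {R : realType}.
Implicit Types (alpha bm bp xi eta J a : R) (f v : R -> R).

Definition Omega_minus alpha : set R := [set x | -1 < x < alpha].
Definition Omega_plus alpha : set R := [set x | alpha < x < 1].

(* The value at x = alpha is never used. *)
Definition coef alpha bm bp : R -> R := fun x => if x < alpha then bm else bp.

(* [lim] is total: these are meaningful only together with the convergence
   conditions of [classical]. *)
Definition trace_right v a : R := lim (v x @[x --> a^'+]).
Definition trace_left v a : R := lim (v x @[x --> a^'-]).

Definition jump alpha v : R := trace_right v alpha - trace_left v alpha.

Definition flux_jump alpha bm bp v : R :=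
  bp * trace_right (derive1 v) alpha - bm * trace_left (derive1 v) alpha.

Record classical alpha v : Prop := Classical {
  classical_derivable : forall x, (Omega_minus alpha `|` Omega_plus alpha) x ->
    derivable v x 1 /\ derivable (derive1 v) x 1;
  classical_cvg_m1 : cvg (v x @[x --> (-1 : R)^'+]);
  classical_cvg_1 : cvg (v x @[x --> (1 : R)^'-]);
  classical_cvg_left : cvg (v x @[x --> alpha^'-]);
  classical_cvg_right : cvg (v x @[x --> alpha^'+]);
  classical_dcvg_left : cvg (derive1 v x @[x --> alpha^'-]);
  classical_dcvg_right : cvg (derive1 v x @[x --> alpha^'+]) }.

Record solution_with_jump alpha bm bp f xi eta J v : Prop := SolutionWithJump {
  solution_classical : classical alpha v;
  solution_ode : forall x, (Omega_minus alpha `|` Omega_plus alpha) x ->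
    - derive1 (fun y => coef alpha bm bp y * derive1 v y) x = f x;
  solution_m1 : trace_right v (-1) = xi;
  solution_1 : trace_left v 1 = eta;
  solution_jump : jump alpha v = J;
  solution_flux : flux_jump alpha bm bp v = 0 }.

Definition interface_solution alpha bm bp f xi eta (g : R -> R -> R) v : Prop :=
  solution_with_jump alpha bm bp f xi eta
    (g (trace_right v alpha) (trace_left v alpha)) v.

Definition zero_jump_component alpha bm bp f xi eta v : Prop :=
  solution_with_jump alpha bm bp f xi eta 0 v.

Definition unit_jump_response alpha bm bp v : Prop :=
  solution_with_jump alpha bm bp (fun=> 0) 0 0 1 v.

End InterfaceProblem.

(* Main.v *)
Require Import Defs.
From mathcomp Require Import all_boot all_order all_algebra.
From mathcomp Require Import all_classical all_reals all_analysis.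
From mathcomp Require Import ring lra.

Set Implicit Arguments.
Unset Strict Implicit.
Unset Printing Implicit Defensive.

Import Order.TTheory GRing.Theory Num.Theory.
Import numFieldNormedType.Exports.

Local Open Scope ring_scope.
Local Open Scope classical_set_scope.

(** The interface problem is linear, and a solution is determined by its
    forcing, boundary values, jump and vanishing flux jump.  With
    [s = jump alpha u], the difference [w = u - u0 - s u1] therefore solves the
    fully homogeneous problem, because the forcing and boundary data of [u] and
    [u0] cancel and the jump [s] of [u] is matched by that of [s u1]
    ([solution_lin]).

    The homogeneous problem has only the zero solution
    ([homogeneous_solution_eq0]).  On either side of [alpha] the coefficient is
    constant, so [w] has vanishing second derivative and is affine
    ([affine_of_derive2_eq0]).  The boundary conditions leave
    [w = c1 (x + 1)] on the left and [w = c2 (x - 1)] on the right.  Continuity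
    at [alpha] gives [c2 (alpha - 1) = c1 (alpha + 1)], which forces [c1] and
    [c2] to have opposite signs, whereas continuity of the flux,
    [bp c2 = bm c1], forces equal signs; hence both vanish. *)

(** * Linearity of the interface problem *)

Section Superposition.
Context {R : realType}.
Implicit Types (alpha bm bp xi eta J a c d x : R) (f g u v w : R -> R).

Lemma open_Omega alpha : open (Omega_minus alpha `|` Omega_plus alpha).
Proof.
suff ioo (a b : R) : open [set x : R | a < x < b] by exact: (openU (ioo _ _) (ioo _ _)).
have -> : [set x : R | a < x < b] = `]a, b[%classic.
  by apply/seteqP; split=> x /=; rewrite in_itv.
exact: interval_open.
Qed.

Lemma is_derive1E u x d : is_derive x 1 u d -> derive1 u x = d.
Proof. by move=> hu; rewrite derive1E; exact: derive_val. Qed.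

Lemma derivable_is_derive1 u x : derivable u x 1 -> is_derive x 1 u (derive1 u x).
Proof. by move=> hu; rewrite derive1E; exact/derivableP. Qed.

Lemma is_derive_lin c u v x du dv :
  is_derive x 1 u du -> is_derive x 1 v dv ->
  is_derive x 1 (fun y => u y + c * v y) (du + c * dv).
Proof. by move=> hu hv; exact: (is_deriveD hu (is_deriveZ c hv)). Qed.

Lemma cvg_lin (F : set_system R) (FF : Filter F) c u v (lu lv : R) :
  u x @[x --> F] --> lu -> v x @[x --> F] --> lv ->
  u x + c * v x @[x --> F] --> lu + c * lv.
Proof. by move=> hu hv; apply: cvgD => //; exact: cvgMl_tmp. Qed.

(** The equality is only required near the limit point so that it covers
    derivatives: [derive1] is linear at points of differentiability, not in general. *)
Lemma near_cvg_lin (F : set_system R) (FF : ProperFilter F) c u v w :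
  (\forall x \near F, w x = u x + c * v x) ->
  cvg (u x @[x --> F]) -> cvg (v x @[x --> F]) ->
  cvg (w x @[x --> F]) /\
  lim (w x @[x --> F]) = lim (u x @[x --> F]) + c * lim (v x @[x --> F]).
Proof.
move=> wE hu hv.
have h : w x @[x --> F] --> lim (u x @[x --> F]) + c * lim (v x @[x --> F]).
  apply: cvg_trans; last exact: (cvg_lin (c := c) _ hu hv).
  by apply: near_eq_cvg; apply: filterS wE => x ->.
by split; [apply/cvg_ex; eexists; exact: h | exact: (cvg_lim _ h)].
Qed.

Lemma derive1_lin alpha c u v x :
  classical alpha u -> classical alpha v ->
  (Omega_minus alpha `|` Omega_plus alpha) x ->
  derive1 (fun y => u y + c * v y) x = derive1 u x + c * derive1 v x.
Proof.
move=> hu hv Ox.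
have [du _] := classical_derivable hu Ox; have [dv _] := classical_derivable hv Ox.
exact: (is_derive1E (is_derive_lin c (derivable_is_derive1 du) (derivable_is_derive1 dv))).
Qed.

(** Differentiability of the derivative of a combination needs the pointwise
    formula [derive1_lin] on a whole neighbourhood, hence openness of the
    domain. *)
Lemma derive2_lin alpha c u v x :
  classical alpha u -> classical alpha v ->
  (Omega_minus alpha `|` Omega_plus alpha) x ->
  is_derive x 1 (derive1 (fun y => u y + c * v y))
    (derive1 (derive1 u) x + c * derive1 (derive1 v) x).
Proof.
move=> hu hv Ox.
have [_ ddu] := classical_derivable hu Ox; have [_ ddv] := classical_derivable hv Ox.
have dlin := is_derive_lin c (derivable_is_derive1 ddu) (derivable_is_derive1 ddv).
refine (near_eq_is_derive _ dlin); near=> y; rewrite (@derive1_lin alpha)//.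
by near: y; apply: open_nbhs_nbhs; split => //; exact: open_Omega.
Unshelve. all: by end_near. Qed.

Lemma cvg_lim_lin (F : set_system R) (FF : ProperFilter F) c u v :
  cvg (u x @[x --> F]) -> cvg (v x @[x --> F]) ->
  cvg (u x + c * v x @[x --> F]) /\
  lim (u x + c * v x @[x --> F]) = lim (u x @[x --> F]) + c * lim (v x @[x --> F]).
Proof. by move=> hu hv; apply: near_cvg_lin => //; near=> x. Unshelve. all: by end_near. Qed.

Lemma near_left_Omega alpha : -1 < alpha ->
  \forall x \near alpha^'-, (Omega_minus alpha `|` Omega_plus alpha) x.
Proof.
move=> lta; near=> x; left; apply/andP; split.
  by near: x; exact: nbhs_left_gt.
by near: x; exact: nbhs_left_lt.
Unshelve. all: by end_near. Qed.

Lemma near_right_Omega alpha : alpha < 1 ->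
  \forall x \near alpha^'+, (Omega_minus alpha `|` Omega_plus alpha) x.
Proof.
move=> gta; near=> x; right; apply/andP; split.
  by near: x; exact: nbhs_right_gt.
by near: x; exact: nbhs_right_lt.
Unshelve. all: by end_near. Qed.

(** Away from [alpha] the coefficient is locally constant, so it commutes with
    differentiation. *)
Lemma is_derive_flux alpha bm bp v d x :
  (Omega_minus alpha `|` Omega_plus alpha) x -> is_derive x 1 (derive1 v) d ->
  is_derive x 1 (fun y => coef alpha bm bp y * derive1 v y) (coef alpha bm bp x * d).
Proof.
move=> Ox hv.
apply: near_eq_is_derive (is_deriveZ (coef alpha bm bp x) hv).
case: Ox => /andP[lx gx]; near=> y; rewrite /coef.
  have ya : y < alpha by near: y; exact: lt_nbhsl.
  by rewrite ya gx.
have ya : alpha < y by near: y; exact: lt_nbhsr.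
by rewrite !ltNge (ltW ya) (ltW lx).
Unshelve. all: by end_near. Qed.

(** The divergence form and the pointwise form of the equation agree; the
    latter is the convenient one for combining and integrating solutions. *)
Lemma solution_ode_coef alpha bm bp f xi eta J v x :
  solution_with_jump alpha bm bp f xi eta J v ->
  (Omega_minus alpha `|` Omega_plus alpha) x ->
  - (coef alpha bm bp x * derive1 (derive1 v) x) = f x.
Proof.
move=> hv Ox; rewrite -(solution_ode hv Ox); congr -%R; apply/esym/is_derive1E.
have [_ ddv] := classical_derivable (solution_classical hv) Ox.
exact: (is_derive_flux _ _ Ox (derivable_is_derive1 ddv)).
Qed.

Lemma solution_lin alpha bm bp f g xi xi' eta eta' J J' c u v : -1 < alpha < 1 ->
  solution_with_jump alpha bm bp f xi eta J u ->
  solution_with_jump alpha bm bp g xi' eta' J' v ->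
  solution_with_jump alpha bm bp (fun x => f x + c * g x)
    (xi + c * xi') (eta + c * eta') (J + c * J') (fun x => u x + c * v x).
Proof.
move=> /andP[lta gta] su sv.
have hu := solution_classical su; have hv := solution_classical sv.
have [_ um1 u1 ul ur dul dur] := hu; have [_ vm1 v1 vl vr dvl dvr] := hv.
have [wm1 wm1E] := cvg_lim_lin _ c um1 vm1.
have [w1 w1E] := cvg_lim_lin _ c u1 v1.
have [wl wlE] := cvg_lim_lin _ c ul vl.
have [wr wrE] := cvg_lim_lin _ c ur vr.
have dE x Ox := @derive1_lin alpha c u v x hu hv Ox.
have [dwl dwlE] := near_cvg_lin _ (filterS dE (near_left_Omega lta)) dul dvl.
have [dwr dwrE] := near_cvg_lin _ (filterS dE (near_right_Omega gta)) dur dvr.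
split.
- apply: Classical wm1 w1 wl wr dwl dwr => x Ox.
  have [du _] := classical_derivable hu Ox; have [dv _] := classical_derivable hv Ox.
  have dw := is_derive_lin c (derivable_is_derive1 du) (derivable_is_derive1 dv).
  exact: (conj (@ex_derive _ _ _ _ _ _ _ dw) (@ex_derive _ _ _ _ _ _ _ (derive2_lin c hu hv Ox))).
- move=> x Ox; rewrite (is_derive1E (is_derive_flux _ _ Ox (derive2_lin c hu hv Ox))).
  have <- := solution_ode_coef su Ox; have <- := solution_ode_coef sv Ox.
  by move: (coef _ _ _ _) (derive1 (derive1 u) x) (derive1 (derive1 v) x) => b p q; ring.
- have <- := solution_m1 su; have <- := solution_m1 sv; exact: wm1E.
- have <- := solution_1 su; have <- := solution_1 sv; exact: w1E.
- rewrite -(solution_jump su) -(solution_jump sv) /jump /trace_right /trace_left wrE wlE.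
  by ring.
- have flux_lin (p q p' q' : R) : bp * (p + c * p') - bm * (q + c * q') =
    (bp * p - bm * q) + c * (bp * p' - bm * q') by ring.
  have fu := solution_flux su; have fv := solution_flux sv.
  rewrite /flux_jump /trace_right /trace_left in fu fv *.
  by rewrite dwrE dwlE flux_lin fu fv mulr0 addr0.
Qed.
End Superposition.

(** * Uniqueness for the homogeneous problem *)

Section Uniqueness.
Context {R : realType}.
Implicit Types (alpha bm bp a b c d x : R) (f v : R -> R).

(** The mean value theorem is applied on closed subintervals [[x, y]], since a
    classical solution is controlled at the endpoints only by one-sided limits. *)
Lemma cst_of_derive1_eq0 f a b : a < b ->
  (forall x, a < x < b -> is_derive x 1 f 0) ->
  exists c, forall x, a < x < b -> f x = c.
Proof.
move=> ab df.
have lecst x y : a < x -> x < y -> y < b -> f x = f y.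
  move=> ax xy yb.
  have sub z : x <= z <= y -> is_derive z 1 f 0.
    move=> /andP[xz zy]; apply: df.
    by rewrite (lt_le_trans ax xz) (le_lt_trans zy yb).
  have [||z _] := @MVT R f (fun=> 0) x y xy.
  - by move=> z; rewrite in_itv/= => /andP[/ltW xz /ltW zy]; apply: sub; rewrite xz.
  - apply: derivable_within_continuous => z; rewrite in_itv/= => /sub[//].
  - by rewrite mul0r => /eqP; rewrite subr_eq0 => /eqP.
have [mab1 mab2] := midf_lt ab.
(* Any interior point serves as reference for the constant value. *)
exists (f ((a + b) / 2)) => x /andP[ax xb].
by have [h|h|->//] := ltgtP x ((a + b) / 2); [exact: lecst | apply/esym/lecst].
Qed.

Lemma affine_of_derive2_eq0 f a b : a < b ->
  (forall x, a < x < b -> derivable f x 1) ->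
  (forall x, a < x < b -> is_derive x 1 (derive1 f) 0) ->
  exists c d, forall x, a < x < b -> f x = c * x + d /\ derive1 f x = c.
Proof.
move=> ab df ddf; have [c hc] := cst_of_derive1_eq0 ab ddf.
have [|d hd] := @cst_of_derive1_eq0 (fun x => f x + - c * x) a b ab.
  move=> x abx; rewrite -(subrr c) -[in X in c - X](mulr1 c) -mulNr.
  apply: is_derive_lin; rewrite -[X in is_derive _ _ f X](hc _ abx).
  exact/derivable_is_derive1/df.
by exists c, d => x abx; split; [rewrite -(hd _ abx); ring | exact: hc].
Qed.

Lemma trace_right_affine f a b c d : a < b ->
  (forall x, a < x < b -> f x = c * x + d) -> trace_right f a = c * a + d.
Proof.
move=> ab fE; apply: cvg_lim => //.
apply: (@cvg_trans _ (c * x + d @[x --> a^'+])).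
  apply: near_eq_cvg; near=> x; apply/esym/fE/andP; split.
    by near: x; exact: nbhs_right_gt.
  by near: x; exact: nbhs_right_lt.
apply: cvgD; last exact: cvg_cst.
by apply: cvgMl_tmp; apply: cvg_at_right_filter; exact: cvg_id.
Unshelve. all: by end_near. Qed.

Lemma trace_left_affine f a b c d : a < b ->
  (forall x, a < x < b -> f x = c * x + d) -> trace_left f b = c * b + d.
Proof.
move=> ab fE; apply: cvg_lim => //.
apply: (@cvg_trans _ (c * x + d @[x --> b^'-])).
  apply: near_eq_cvg; near=> x; apply/esym/fE/andP; split.
    by near: x; exact: nbhs_left_gt.
  by near: x; exact: nbhs_left_lt.
apply: cvgD; last exact: cvg_cst.
by apply: cvgMl_tmp; apply: cvg_at_left_filter; exact: cvg_id.
Unshelve. all: by end_near. Qed.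

(** Both one-sided affine pieces are determined by their slopes, and the two
    interface conditions form a homogeneous system for these slopes with
    determinant [bp (alpha + 1) + bm (1 - alpha) > 0]. *)
Lemma homogeneous_solution_eq0 alpha bm bp v : -1 < alpha < 1 -> 0 < bm -> 0 < bp ->
  solution_with_jump alpha bm bp (fun=> 0) 0 0 0 v ->
  forall x, (Omega_minus alpha `|` Omega_plus alpha) x -> v x = 0.
Proof.
move=> /andP[lta gta] bm0 bp0 sv.
have cv := solution_classical sv.
have dv x (Ox : (Omega_minus alpha `|` Omega_plus alpha) x) : derivable v x 1.
  by have [] := classical_derivable cv Ox.
have ddv x (Ox : (Omega_minus alpha `|` Omega_plus alpha) x) :
    is_derive x 1 (derive1 v) 0.
  have [_ /derivable_is_derive1] := classical_derivable cv Ox.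
  suff -> : derive1 (derive1 v) x = 0 by [].
  apply/eqP; have /eqP := solution_ode_coef sv Ox.
  rewrite oppr_eq0 mulf_eq0 => /orP[|//].
  by rewrite /coef; case: ifP => _; rewrite gt_eqF.
have [x Ox|x Ox|c1 [d1 v1]] := @affine_of_derive2_eq0 v _ _ lta.
- by apply: dv; left.
- by apply: ddv; left.
have [x Ox|x Ox|c2 [d2 v2]] := @affine_of_derive2_eq0 v _ _ gta.
- by apply: dv; right.
- by apply: ddv; right.
have v1E x Ox := (v1 x Ox).1; have v2E x Ox := (v2 x Ox).1.
(* The derivative is written as an affine function so that its traces are given
   by the same lemmas as those of [v]. *)
have dv1 x (Ox : -1 < x < alpha) : derive1 v x = 0 * x + c1.
  by rewrite (v1 x Ox).2 mul0r add0r.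
have dv2 x (Ox : alpha < x < 1) : derive1 v x = 0 * x + c2.
  by rewrite (v2 x Ox).2 mul0r add0r.
have := solution_m1 sv; rewrite (trace_right_affine lta v1E) => e1.
have := solution_1 sv; rewrite (trace_left_affine gta v2E) => e2.
have := solution_jump sv.
rewrite /jump (trace_right_affine gta v2E) (trace_left_affine lta v1E) => e3.
have := solution_flux sv.
rewrite /flux_jump (trace_right_affine gta dv2) (trace_left_affine lta dv1) => e4.
have d1E : d1 = c1 by lra.
have d2E : d2 = - c2 by lra.
(* Eliminate [c2] between the jump condition, multiplied by [bp], and the flux
   condition, multiplied by [alpha - 1]. *)
have c10 : c1 = 0.
  have : c1 * (bp * (alpha + 1) + bm * (1 - alpha)) = 0.
    transitivity ((alpha - 1) * (bp * (0 * alpha + c2) - bm * (0 * alpha + c1))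
        - bp * (c2 * alpha + d2 - (c1 * alpha + d1))).
      by rewrite d1E d2E; ring.
    by rewrite e3 e4 !mulr0 subr0.
  move/eqP; rewrite mulf_eq0 => /orP[/eqP//|]; rewrite gt_eqF// addr_gt0// mulr_gt0//; lra.
have c20 : c2 = 0.
  have /eqP : bp * c2 = 0 by move: e4; rewrite c10; lra.
  by rewrite mulf_eq0 (gt_eqF bp0) => /eqP.
by move=> x [Ox|Ox]; rewrite ?(v1E x Ox) ?(v2E x Ox) ?d1E ?d2E ?c10 ?c20; ring.
Qed.

End Uniqueness.

(** * The decomposition *)

Theorem proposition2p1 (R : realType) (alpha bm bp xi eta : R)
    (f : R -> R) (g : R -> R -> R) (u u0 u1 : R -> R)
    (halpha : -1 < alpha < 1) (hbm : 0 < bm) (hbp : 0 < bp)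
    (hu : interface_solution alpha bm bp f xi eta g u)
    (hu0 : zero_jump_component alpha bm bp f xi eta u0)
    (hu1 : unit_jump_response alpha bm bp u1) :
  exists s : R,
    (forall x, (Omega_minus alpha `|` Omega_plus alpha) x ->
       u x = u0 x + s * u1 x)
    /\ s = jump alpha u.
Proof.
exists (jump alpha u); split=> // x Ox.
set w := fun y => u y + -1 * u0 y + - jump alpha u * u1 y.
have sw : solution_with_jump alpha bm bp (fun=> 0) 0 0 0 w.
  have := solution_lin (- jump alpha u) halpha (solution_lin (-1) halpha hu hu0) hu1.
  rewrite -(solution_jump hu); congr solution_with_jump; try by ring.
  by apply/funext => y; ring.
have wE : u x - (u0 x + jump alpha u * u1 x) = w x by rewrite /w; ring.
by apply/eqP; rewrite -subr_eq0 wE (homogeneous_solution_eq0 halpha hbm hbp sw Ox).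
Qed.
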